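(* Let $I\subseteq \Bbbk[x_i,x_j,x_k]$ be a monomial ideal, let $\mathbf a\prec\mathbf b$ be vectors in $\mathbb N^3$ such that $\dim_\Bbbk \widetilde H_0(K^{\mathbf b}I;\Bbbk)\neq 0$ and $\mathbf x^{\mathbf a}$ is a minimal monomial generator of $I$. Then the sylvan matrix entries $D^{\mathbf a\mathbf b}_{\varnothing v}$ ($v$ a vertex of $K^{\mathbf b}I$) are as follows. 1. If $i$ is an isolated vertex of $K^{\mathbf b}I$ and $\mathbf a$ is the (unique) generator degree that lies behind $\mathbf b$ in the $i$-direction, then $D^{\mathbf a\mathbf b}_{\varnothing i}=1$. 2. If $\mathbf a$ does not lie behind $\mathbf b$ in the direction of the connected component of $v$ in $K^{\mathbf b}I$, then $D^{\mathbf a\mathbf b}_{\varnothing v}=0$. 3. Suppose $K^{\mathbf b}I$ is the complex with facets the edge $\{i,j\}$ and the isolated vertex $k$, and $\mathbf a$ lies behind $\mathbf b$ in the direction of the edge $\{i,j\}$. For a lattice path $\lambda\in\Lambda(\mathbf a,\mathbf b)$, let $\mathbf b_\lambda$ be the degree vector on $\lambda$ closest to $\mathbf b$ such that $K^{\mathbf b_\lambda}I$ contains one or fewer vertices, and let $n$ be the length of $\lambda$ (so $n=|\mathbf b-\mathbf a|$). Then $$D^{\mathbf a\mathbf b}_{\varnothing i}=\frac1{2^n}\sum_{\lambda\in\Lambda(\mathbf a,\mathbf b)}2^{|\mathbf b_\lambda-\mathbf a|}.$$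
   Context: Throughout $\Bbbk$ is a field with $\operatorname{char}(\Bbbk)\neq 2,3$; $\{i,j,k\}$ is the set of the three variable indices in an arbitrary labelling; $\mathbf e_i,\mathbf e_j,\mathbf e_k$ are the standard basis vectors of $\mathbb N^3$; $\preceq$ is the componentwise order on $\mathbb N^3$, $\mathbf a\prec\mathbf b$ means $\mathbf a\preceq\mathbf b$ and $\mathbf a\ne\mathbf b$, and $|\mathbf c|$ is the sum of the coordinates of $\mathbf c$. Koszul complex: $K^{\mathbf b}I=\{\tau\subseteq\{i,j,k\}: \mathbf x^{\mathbf b-\tau}\in I\}$, where $\tau$ is identified with its $0/1$ indicator vector (a monomial with a negative exponent is not in $I$). A degree $\mathbf a$ ''lies behind $\mathbf b$ in the direction of $F$'' ($F$ a set of vertices) if $\mathbf a\preceq\mathbf b$ and $\operatorname{supp}(\mathbf b-\mathbf a)\subseteq F$; ''in the $i$-direction'' means $F=\{i\}$. Fix a total order on the vertices to orient faces. For a simplicial complex $K$, $K_d$ is the set of $d$-faces, $\widetilde C_d$ and $\widetilde B_d$ the reduced chains and boundaries over $\Bbbk$, $\partial$ the reduced boundary map (so $\partial v=\varnothing$). A shrubbery in dimension $d$ is $T_d\subseteq K_d$ whose boundaries $\partial\tau$, $\tau\in T_d$, form a basis of $\widetilde B_{d-1}(K)$. A stake set in dimension $d$ is $S_d\subseteq K_d$ whose complement $K_d\setminus S_d$ gives a basis of $\widetilde C_d(K)/\widetilde B_d(K)$. A hedge of dimension $d$ is a pair $ST_d=(S_{d-1},T_d)$. The circuit of a $d$-face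 $\tau$ is the unique cycle $\zeta_{T_d}(\tau)=\tau-t$ with $t\in\Bbbk\{T_d\}$; $\tau$ is cycle-linked to $\tau'$ if $\tau'$ has nonzero coefficient in it. The shrub of a stake $\sigma\in S_{d-1}$ is the unique chain $s(\sigma)\in\Bbbk\{T_d\}$ whose boundary has coefficient $1$ on $\sigma$ and $0$ on all other stakes in $S_{d-1}$; $\sigma$ is chain-linked to $\tau'$ if $\tau'$ has nonzero coefficient in $s(\sigma)$. The hedge rim of a $d$-face $\tau$ is the unique chain $r(\tau)\in\Bbbk\{K_d\setminus S_d\}$ with $\tau-r(\tau)$ a boundary; $\tau$ is boundary-linked to $\tau'$ if $\tau'$ has nonzero coefficient in $r(\tau)$. $\Lambda(\mathbf a,\mathbf b)$ is the set of saturated decreasing lattice paths $\lambda=(\mathbf a=\mathbf b_n,\mathbf b_{n-1},\dots,\mathbf b_1,\mathbf b_0=\mathbf b)$, i.e. $\mathbf b_{\ell-1}-\mathbf b_\ell$ is a standard basis vector $\mathbf e_{k_\ell}$ for each $\ell$. A hedgerow in dimension $d$ on $\lambda$ consists of a stake set $S_d^{\mathbf b}$ in $K^{\mathbf b}I$, a hedge of dimension $d$ in $K^{\mathbf b_\ell}I$ for $\ell=1,\dots,n-1$, and a shrubbery $T_{d-1}^{\mathbf a}$ in $K^{\mathbf a}I$. A chain-link fence along $\lambda$ from a $d$-face $\tau$ of $K^{\mathbf b}I$ to a $(d-1)$-face $\sigma$ of $K^{\mathbf a}I$ consists of a hedgerow and faces $\tau_0,\sigma_1,\tau_1,\dots,\sigma_{n-1},\tau_{n-1},\sigma_n$,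 with $\tau_\ell\in K_d^{\mathbf b_\ell}I$ and $\sigma_\ell\in K_{d-1}^{\mathbf b_\ell}I$, such that $\tau$ is boundary-linked to $\tau_0$; $\sigma_\ell=\tau_{\ell-1}\setminus\{k_\ell\}$ (with $k_\ell\in\tau_{\ell-1}$) for $\ell=1,\dots,n$; $\sigma_\ell$ is a stake in $S_{d-1}^{\mathbf b_\ell}$ chain-linked to $\tau_\ell$ for $1\le\ell\le n-1$; and $\sigma_n$ is cycle-linked to $\sigma$. Its weight $w_\phi$ is the product of: the coefficient of $\tau_0$ in the hedge rim of $\tau$; the coefficients of $\tau_\ell$ in the shrub of $\sigma_\ell$; the coefficients of $\sigma_\ell$ in $\partial\tau_{\ell-1}$; and the coefficient of $\sigma$ in the circuit of $\sigma_n$. (In three variables the extra determinant factors in the general weights are all $1$.) The sylvan matrix entry, for a $d$-face $\tau\in K^{\mathbf b}I$ and a $(d-1)$-face $\sigma\in K^{\mathbf a}I$, is $$D^{\mathbf a\mathbf b}_{\sigma\tau}=\sum_{\lambda\in\Lambda(\mathbf a,\mathbf b)}\frac1{\Delta_{d,\lambda}I}\sum_{\phi}w_\phi,$$ where $\Delta_{d,\lambda}I$ is the number of hedgerows of dimension $d$ on $\lambda$ and $\phi$ runs over the chain-link fences from $\tau$ to $\sigma$ along $\lambda$. Here $d=0$. *)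

(* Defs.v *)
From HB Require Import structures.
From mathcomp Require Import all_boot all_order all_algebra.
From mathcomp Require Import mpoly.
From mathcomp Require classical_sets.

Set Implicit Arguments.
Unset Strict Implicit.
Unset Printing Implicit Defensive.

Import GRing.Theory.
Local Open Scope ring_scope.

(* The variables are indexed by 'I_3, whose natural order orients the faces.
   Degrees in N^3 are multinomials: (a <= b)%MM is the componentwise order,
   U_(i)%MM the i-th standard basis vector, mdeg the sum of the coordinates. *)
Notation face := {set 'I_3}.
Notation complex := {set {set 'I_3}}.

(** * Monomial ideals and Koszul complexes *)

Definition monomial_ideal (F : fieldType) (I : {pred {mpoly F[3]}}) : Prop :=
  exists M : {pred 'X_{1..3}}, forall p : {mpoly F[3]},
    p \in I <->
    exists (r : seq 'X_{1..3}) (q : 'X_{1..3} -> {mpoly F[3]}),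
      all (mem M) r /\ p = \sum_(m <- r) q m * 'X_[m].

Definition min_generator (F : fieldType) (I : {pred {mpoly F[3]}})
    (a : 'X_{1..3}) : Prop :=
  'X_[a] \in I /\
  forall c : 'X_{1..3}, (c <= a)%MM -> 'X_[c] \in I -> c = a.

Definition indic (tau : face) : 'X_{1..3} := [multinom (i \in tau : nat) | i < 3].

(* Subtraction of multinomials is truncated; the first conjunct discards the
   faces for which b - tau has a negative coordinate. *)
Definition koszul (F : fieldType) (I : {pred {mpoly F[3]}}) (b : 'X_{1..3}) :
    complex :=
  [set tau | (indic tau <= b)%MM && ('X_[b - indic tau] \in I)].

Definition lies_behind (a b : 'X_{1..3}) (G : {set 'I_3}) : bool :=
  (a <= b)%MM && ([set l | (b - a)%MM l != 0%N] \subset G).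

(** * Combinatorics of simplicial complexes *)

Definition vertices (K : complex) : {set 'I_3} := [set v | [set v] \in K].

Definition isolated (K : complex) (v : 'I_3) : Prop :=
  [set v] \in K /\ forall tau : face, tau \in K -> v \in tau -> tau = [set v].

Definition component (K : complex) (v : 'I_3) : {set 'I_3} :=
  [set w | connect (fun u u' : 'I_3 => [set u; u'] \in K) v w].

Definition facets (K : complex) : complex := [set tau | maxset (mem K) tau].

(* Dimensions are integers: the empty face has dimension -1. *)
Definition faces (K : complex) (d : int) : complex :=
  [set tau in K | #|tau|%:Z == d + 1].

(** * Reduced chains *)

(* A chain is a combination of arbitrary subsets of the variables; the chains
   of a given complex and dimension form the subspace [chains] below. *)
Notation chain F := {ffun {set 'I_3} -> F^o}.

Definition coef (F : fieldType) (c : chain F) (tau : face) : F := c tau.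

Definition fchain (F : fieldType) (tau : face) : chain F :=
  [ffun sigma => (sigma == tau)%:R].

Definition bdry_face (F : fieldType) (tau : face) : chain F :=
  \sum_(v in tau)
    (-1) ^+ #|[set w in tau | (w < v)%N]| *: fchain F (tau :\ v).

Definition bdry_fun (F : fieldType) (c : chain F) : chain F :=
  \sum_(tau : face) coef c tau *: bdry_face F tau.

Fact bdry_fun_is_linear (F : fieldType) : linear (@bdry_fun F).
Proof.
move=> a c c'; rewrite /bdry_fun scaler_sumr -big_split /=.
by apply: eq_bigr => tau _; rewrite /coef !ffunE scalerDl scalerA.
Qed.

HB.instance Definition _ (F : fieldType) :=
  GRing.isLinear.Build F (chain F) (chain F) _ (@bdry_fun F)
    (bdry_fun_is_linear (F := F)).

Definition bdry (F : fieldType) : 'End(chain F) := linfun (@bdry_fun F).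

Definition fchains (F : fieldType) (A : complex) : seq (chain F) :=
  [seq fchain F tau | tau <- enum A].

Definition chains (F : fieldType) (K : complex) (d : int) : {vspace chain F} :=
  <<fchains F (faces K d)>>%VS.

Definition cycles (F : fieldType) (K : complex) (d : int) : {vspace chain F} :=
  (chains F K d :&: lker (bdry F))%VS.

Definition boundaries (F : fieldType) (K : complex) (d : int) :
    {vspace chain F} :=
  (bdry F @: chains F K (d + 1))%VS.

(* The quotient of cycles by boundaries, realized as a complement of the
   boundaries in the cycles. *)
Definition red_homology (F : fieldType) (K : complex) (d : int) :
    {vspace chain F} :=
  (cycles F K d :\: boundaries F K d)%VS.

(** * Shrubberies, stake sets and hedges *)

Definition shrubbery (F : fieldType) (K : complex) (d : int) (T : complex) :
    bool :=
  (T \subset faces K d) &&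
  basis_of (boundaries F K (d - 1)) [seq bdry F c | c <- fchains F T].

(* The classes of the vectors of X form a basis of the quotient U / W: they are
   independent modulo W and, together with W, they span U. *)
Definition basis_mod (F : fieldType) (vT : vectType F) (U W : {vspace vT})
    (X : seq vT) : bool :=
  [&& free X, (<<X>> :&: W == 0)%VS & (<<X>> + W == U)%VS].

Definition stake_set (F : fieldType) (K : complex) (d : int) (S : complex) :
    bool :=
  (S \subset faces K d) &&
  basis_mod (chains F K d) (boundaries F K d) (fchains F (faces K d :\: S)).

Definition hedge (F : fieldType) (K : complex) (d : int)
    (ST : complex * complex) : bool :=
  stake_set F K (d - 1) ST.1 && shrubbery F K d ST.2.

(* The chain with property P, for P satisfied by exactly one chain. *)
Definition the_chain (F : fieldType) (P : chain F -> Prop) : chain F :=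
  classical_sets.xget 0 P.

Definition circuit (F : fieldType) (T : complex) (tau : face) : chain F :=
  the_chain (fun z => bdry F z = 0 /\ fchain F tau - z \in <<fchains F T>>%VS).

Definition shrub (F : fieldType) (S T : complex) (sigma : face) : chain F :=
  the_chain (fun s =>
    [/\ s \in <<fchains F T>>%VS, coef (bdry F s) sigma = 1
      & forall sigma' : face, sigma' \in S -> sigma' != sigma ->
          coef (bdry F s) sigma' = 0]).

Definition rim (F : fieldType) (K : complex) (d : int) (S : complex)
    (tau : face) : chain F :=
  the_chain (fun r => r \in <<fchains F (faces K d :\: S)>>%VS /\
                      fchain F tau - r \in boundaries F K d).

(** * Lattice paths, hedgerows and chain-link fences *)

(* A decreasing lattice path of length n ending at a is recorded by its steps
   k_1, ..., k_n, with k_l stored at position l - 1.  Its l-th degree is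
   b_l = a + e_{k_(l+1)} + ... + e_{k_n}, so that b_n = a and
   b_(l-1) - b_l = e_{k_l}. *)
Definition step (ks : seq 'I_3) (l : nat) : 'I_3 := nth ord0 ks l.-1.

Definition path_deg (a : 'X_{1..3}) (ks : seq 'I_3) (l : nat) : 'X_{1..3} :=
  (a + \sum_(l.+1 <= m < (size ks).+1) U_(step ks m))%MM.

Definition lattice_paths (a b : 'X_{1..3}) :
    {set (mdeg (b - a)).-tuple 'I_3} :=
  [set ks : (mdeg (b - a)).-tuple 'I_3 | path_deg a ks 0 == b].

(* The data of a hedgerow on a path of length n: S_d^b, then the hedges
   (S_(d-1), T_d) at b_1, ..., b_(n-1), then T_(d-1)^a. *)
Notation hedgerow_data n :=
  (complex * (n.-1).-tuple (complex * complex) * complex)%type.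

Definition top_stakes n (H : hedgerow_data n) : complex := H.1.1.
Definition hedge_at n (H : hedgerow_data n) (l : nat) : complex * complex :=
  nth (set0, set0) H.1.2 l.-1.
Definition bottom_shrubbery n (H : hedgerow_data n) : complex := H.2.

Definition hedgerows (F : fieldType) (I : {pred {mpoly F[3]}}) (d : int)
    (a : 'X_{1..3}) n (ks : n.-tuple 'I_3) : {set hedgerow_data n} :=
  [set H : hedgerow_data n |
    [&& stake_set F (koszul I (path_deg a ks 0)) d (top_stakes H),
        all (fun l => hedge F (koszul I (path_deg a ks l)) d (hedge_at H l))
            (iota 1 n.-1)
      & shrubbery F (koszul I a) (d - 1) (bottom_shrubbery H)]].

(* The data of a fence: a hedgerow, the faces tau_0, ..., tau_(n-1) and the
   faces sigma_1, ..., sigma_n. *)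
Notation fence_data n :=
  (hedgerow_data n * (n.-tuple face * n.-tuple face))%type.

Definition fence_tau n (phi : fence_data n) (l : nat) : face :=
  nth set0 phi.2.1 l.
Definition fence_sigma n (phi : fence_data n) (l : nat) : face :=
  nth set0 phi.2.2 l.-1.

Definition fence_rim (F : fieldType) (I : {pred {mpoly F[3]}}) (d : int)
    (a : 'X_{1..3}) n (ks : n.-tuple 'I_3) (tau : face) (phi : fence_data n) :
    chain F :=
  rim F (koszul I (path_deg a ks 0)) d (top_stakes phi.1) tau.

Definition fence_shrub (F : fieldType) n (phi : fence_data n) (l : nat) :
    chain F :=
  shrub F (hedge_at phi.1 l).1 (hedge_at phi.1 l).2 (fence_sigma phi l).

Definition fence_circuit (F : fieldType) n (phi : fence_data n) : chain F :=
  circuit F (bottom_shrubbery phi.1) (fence_sigma phi n).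

Definition fences (F : fieldType) (I : {pred {mpoly F[3]}}) (d : int)
    (a : 'X_{1..3}) n (ks : n.-tuple 'I_3) (tau sigma : face) :
    {set fence_data n} :=
  [set phi : fence_data n |
    [&& phi.1 \in hedgerows I d a ks,
        all (fun l => fence_tau phi l \in faces (koszul I (path_deg a ks l)) d)
            (iota 0 n),
        all (fun l =>
              fence_sigma phi l \in faces (koszul I (path_deg a ks l)) (d - 1))
            (iota 1 n),
        coef (fence_rim I d a ks tau phi) (fence_tau phi 0) != 0,
        all (fun l =>
              (step ks l \in fence_tau phi l.-1) &&
              (fence_sigma phi l == fence_tau phi l.-1 :\ step ks l))
            (iota 1 n),
        all (fun l =>
              (fence_sigma phi l \in (hedge_at phi.1 l).1) &&
              (coef (fence_shrub F phi l) (fence_tau phi l) != 0))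
            (iota 1 n.-1)
      & coef (fence_circuit F phi) sigma != 0]].

Definition weight (F : fieldType) (I : {pred {mpoly F[3]}}) (d : int)
    (a : 'X_{1..3}) n (ks : n.-tuple 'I_3) (tau sigma : face)
    (phi : fence_data n) : F :=
  coef (fence_rim I d a ks tau phi) (fence_tau phi 0) *
  (\prod_(1 <= l < n) coef (fence_shrub F phi l) (fence_tau phi l)) *
  (\prod_(1 <= l < n.+1)
      coef (bdry F (fchain F (fence_tau phi l.-1))) (fence_sigma phi l)) *
  coef (fence_circuit F phi) sigma.

Definition sylvan (F : fieldType) (I : {pred {mpoly F[3]}}) (d : int)
    (a b : 'X_{1..3}) (sigma tau : face) : F :=
  \sum_(ks in lattice_paths a b)
    (#|hedgerows I d a ks|%:R)^-1 *
    \sum_(phi in fences I d a ks tau sigma) weight I d a ks tau sigma phi.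

(* The degree b_l on the path with l minimal such that the Koszul complex at
   b_l has at most one vertex.  When a is the degree of a minimal generator, the
   default value l = n, where b_n = a, satisfies this condition. *)
Definition closest_deg (F : fieldType) (I : {pred {mpoly F[3]}})
    (a : 'X_{1..3}) n (ks : n.-tuple 'I_3) : 'X_{1..3} :=
  path_deg a ks
    [arg min_(l < (ord_max : 'I_n.+1)
               | (#|vertices (koszul I (path_deg a ks l))| <= 1)%N) (l : nat)].

(* Main.v *)
Require Import Defs.
From mathcomp Require Import all_boot all_order all_algebra.
From mathcomp Require Import mpoly zify.
From mathcomp Require classical_sets.

(* In dimension 0 every fence is forced by its hedgerow: since tau_l is a vertex
   containing k_(l+1), it is {k_(l+1)}, all sigma_l are empty, and the shrub of
   the empty face is the unique vertex of T_0.  So the weights along a path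
   lambda factor over the degrees of lambda, and the average over hedgerows
   equals
     (average over stake sets S at b of the coefficient of k_1 in the rim of v)
       * prod_(1 <= l < n) 1 / #(vertices of K^(b_l)).
   The rim of v is supported on the component of v.  If some coordinate w
   outside that component differs between a and b, then k_1 in the component
   would give an edge {k_1, w}, because a <= b - e_(k_1) - e_w.  In
   parts 1 and 3 the same argument confines the vertices of K^(b_l), l > 0, to
   the component of i.  So in part 1 there is one of them, and in part 3 there
   are two before b_lambda is reached and one from there on. *)

Set Implicit Arguments.
Unset Strict Implicit.
Unset Printing Implicit Defensive.

Import GRing.Theory.
Local Open Scope ring_scope.

(** * Chains *)

Lemma span_ind (F : fieldType) (vT : vectType F) (X : seq vT)
    (P : vT -> Prop) :
  P 0 -> (forall c x y, x \in X -> P y -> P (c *: x + y)) ->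
  forall x, x \in <<X>>%VS -> P x.
Proof.
move=> P0 PS x; rewrite -[X]in_tupleE => /coord_span->.
elim/big_rec: _ => // l y _ Py; apply: PS => //.
by rewrite mem_nth.
Qed.

Section Chains.

Variable F : fieldType.
Implicit Types (A K S T X : complex) (sigma tau : face) (x y z : chain F).
Implicit Types (u v w : 'I_3).

Lemma chain_coefD x y tau : coef (x + y) tau = coef x tau + coef y tau.
Proof. by rewrite /coef ffunE. Qed.

Lemma chain_coefZ (c : F) x tau : coef (c *: x) tau = c * coef x tau.
Proof. by rewrite /coef ffunE. Qed.

Lemma chain_coefN x tau : coef (- x) tau = - coef x tau.
Proof. by rewrite /coef ffunE. Qed.

Lemma chain_coefB x y tau : coef (x - y) tau = coef x tau - coef y tau.
Proof. by rewrite chain_coefD chain_coefN. Qed.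

Lemma chain_coef0 tau : coef (0 : chain F) tau = 0.
Proof. by rewrite /coef ffunE. Qed.

Lemma chain_coef_sum (J : Type) (r : seq J) (P : pred J) (f : J -> chain F) tau
  :
  coef (\sum_(l <- r | P l) f l) tau = \sum_(l <- r | P l) coef (f l) tau.
Proof.
by elim/big_rec2: _ => [|l c x _ <-]; rewrite ?chain_coef0 ?chain_coefD.
Qed.

Lemma coef_fchain tau sigma : coef (fchain F tau) sigma = (sigma == tau)%:R.
Proof. by rewrite /coef ffunE. Qed.

Definition chain_coefE := (chain_coefB, chain_coefD, chain_coefZ, chain_coefN,
  chain_coef0, coef_fchain).

Lemma chain_expand x : x = \sum_tau coef x tau *: fchain F tau.
Proof.
apply/ffunP=> sigma; rewrite -!/(coef _ sigma) chain_coef_sum (bigD1 sigma) //=.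
rewrite !chain_coefE eqxx mulr1 big1 ?addr0 // => tau /negPf ne.
by rewrite !chain_coefE eq_sym ne mulr0.
Qed.

Lemma fchain_neq0 tau : fchain F tau != 0.
Proof.
apply/eqP=> /ffunP/(_ tau); rewrite !ffunE eqxx => /eqP.
by rewrite oner_eq0.
Qed.

Lemma mem_fchains A x :
  x \in fchains F A -> exists2 tau, tau \in A & x = fchain F tau.
Proof. by case/mapP=> tau; rewrite mem_enum; exists tau. Qed.

Lemma span_fchainsP A x :
  reflect (forall tau, tau \notin A -> coef x tau = 0)
          (x \in <<fchains F A>>%VS).
Proof.
apply: (iffP idP) => [xA tau AN | x0].
  elim/span_ind: xA => [|c y z /mem_fchains[sigma As ->] z0];
    rewrite !chain_coefE //.
  by case: eqP AN => [->|_ _]; rewrite ?As // mulr0 z0 addr0.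
rewrite [x]chain_expand memv_suml // => tau _.
have [At|/x0->] := boolP (tau \in A); last by rewrite scale0r mem0v.
by rewrite memvZ // memv_span // map_f // mem_enum.
Qed.

Lemma fchain_span A tau : (fchain F tau \in <<fchains F A>>%VS) = (tau \in A).
Proof.
apply/span_fchainsP/idP => [|At sigma sA].
  by apply: contraPT => tA /(_ _ tA)/eqP; rewrite !chain_coefE eqxx oner_eq0.
by rewrite !chain_coefE; case: eqP sA => // ->; rewrite At.
Qed.

Lemma free_fchains A : free (fchains F A).
Proof.
rewrite -[fchains F A]in_tupleE; apply/freeP => c /ffunP sum0 l.
have ltl (m : 'I_(size (fchains F A))) : (m < size (enum A))%N.
  by rewrite -(size_map (fchain F)).
(* Evaluating the vanishing combination at the [l]-th face isolates the [l]-th coefficient. *)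
have := sum0 (nth set0 (enum A) l); rewrite -!/(coef _ _) chain_coef_sum
  chain_coef0.
rewrite (bigD1 l) //= !chain_coefE big1 => [|m ml].
  by rewrite (nth_map set0) ?ltl // !chain_coefE eqxx mulr1 addr0.
rewrite (nth_map set0) ?ltl // !chain_coefE nth_uniq ?enum_uniq ?ltl //.
by rewrite (inj_eq val_inj) eq_sym (negPf ml) mulr0.
Qed.

Lemma bdry_fchain tau : bdry F (fchain F tau) = bdry_face F tau.
Proof.
rewrite lfunE /= /bdry_fun (bigD1 tau) //= !chain_coefE eqxx scale1r big1
  ?addr0 //.
by move=> sigma /negPf ne; rewrite !chain_coefE ne scale0r.
Qed.

Lemma bdry_face0 : bdry_face F set0 = 0.
Proof. by rewrite /bdry_face big_set0. Qed.

Lemma bdry_face1 v : bdry_face F [set v] = fchain F set0.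
Proof.
rewrite /bdry_face big_set1 setDv (_ : [set w in _ | _] = set0) ?cards0.
  by rewrite scale1r.
by apply/setP=> w; rewrite !inE; case: eqP => //= ->; rewrite ltnn.
Qed.

Lemma bdry_face2 u v : (u < v)%N ->
  bdry_face F [set u; v] = fchain F [set v] - fchain F [set u].
Proof.
move=> uv; have uv' : u != v by apply: contraTneq uv => ->; rewrite ltnn.
rewrite /bdry_face big_setU1 ?inE //= big_set1.
have -> : [set u; v] :\ u = [set v].
  by apply/setP=> w; rewrite !inE; case: eqP => // ->; rewrite (negPf uv').
have -> : [set u; v] :\ v = [set u].
  apply/setP=> w; rewrite !inE orbC; case: eqP => //= ->.
  by rewrite eq_sym (negPf uv').
have -> : [set w in [set u; v] | (w < u)%N] = set0.
  apply/setP=> w; rewrite !inE.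
  by case: (eqVneq w u) => [->|_] /=; [rewrite ltnn | case: eqP => //= ->; lia].
have -> : [set w in [set u; v] | (w < v)%N] = [set u].
  apply/setP=> w; rewrite !inE; case: (eqVneq w u) => [->|_] //=.
  by case: eqP => //= ->; rewrite ltnn.
by rewrite cards0 cards1 expr0 expr1 scale1r scaleN1r.
Qed.

Lemma mem_faces K d tau :
  (tau \in faces K d) = (tau \in K) && (#|tau|%:Z == d + 1).
Proof. by rewrite inE. Qed.

Lemma mem_faces0 K tau :
  (tau \in faces K 0) = (tau \in K) && (#|tau| == 1%N).
Proof. by rewrite inE. Qed.

Lemma facesN1 K : set0 \in K -> faces K (0 - 1) = [set set0].
Proof.
move=> K0; apply/setP=> tau; rewrite mem_faces inE.
rewrite (_ : _ == _ = (#|tau| == 0%N)) // cards_eq0.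
by case: eqP => [->|_]; rewrite ?K0 ?andbF.
Qed.

Lemma edge_faces K tau : tau \in faces K (0 + 1) ->
  exists u v, [/\ (u < v)%N, tau = [set u; v] & [set u; v] \in K].
Proof.
rewrite mem_faces => /andP[Kt]; rewrite (_ : _ == _ = (#|tau| == 2%N)) //.
case/cards2P=> u [v [uv def]]; rewrite def in Kt *.
case: (ltngtP u v) uv => [||/val_inj->]; last by rewrite eqxx.
  by exists u, v.
by exists v, u; split; rewrite // setUC.
Qed.

(** Every edge can be written with increasing endpoints, and its boundary is then their difference.
    These differences span the boundaries of dimension 0. *)
Lemma boundaries0_ind K (P : chain F -> Prop) :
  P 0 ->
  (forall (c : F) (u v : 'I_3) x, (u < v)%N -> [set u; v] \in K -> P x ->
     P (c *: (fchain F [set v] - fchain F [set u]) + x)) ->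
  forall x, x \in boundaries F K 0 -> P x.
Proof.
move=> P0 PS x; rewrite /boundaries /chains limg_span.
apply: span_ind => // c y z /mapP[t /mem_fchains[tau /edge_faces]].
by move=> [u [v [uv -> Kuv]]] -> -> Pz; rewrite bdry_fchain bdry_face2; auto.
Qed.

(** These are the two facts that make hedge rims well defined: trivial intersection with the
    boundaries gives uniqueness, spanning gives existence. *)
Lemma stake_set_mod K S : stake_set F K 0 S ->
  let X := faces K 0 :\: S in
  (forall x, x \in <<fchains F X>>%VS -> x \in boundaries F K 0 -> x = 0) /\
  (forall v, [set v] \in K ->
     exists2 x, x \in <<fchains F X>>%VS & fchain F [set v] - x \in boundaries
       F K 0).
Proof.
case/andP=> _ /and3P[_ /eqP cap0 /eqP span]; split=> [x xX xB | v Kv].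
  by apply/eqP; rewrite -memv0 -cap0 memv_cap xX.
have: fchain F [set v] \in chains F K 0.
  by rewrite fchain_span mem_faces0 Kv cards1.
rewrite -span => /memv_addP[x xX [y yB ->]].
by exists x => //; rewrite addrC addKr.
Qed.

End Chains.

(** * Hedges in dimension zero *)

Section Hedges.

Variable F : fieldType.
Implicit Types (A K S T X : complex) (sigma tau : face) (x y z : chain F).
Implicit Types (u v w : 'I_3).

Lemma eq_size_basis (vT : vectType F) (U : {vspace vT}) (s : seq vT) :
  basis_of U s -> \dim U = size s.
Proof. by case/andP=> /eqP<- /eqP. Qed.

Lemma mem_vertices K v : (v \in vertices K) = ([set v] \in K).
Proof. by rewrite inE. Qed.

(** Every vertex has the empty face as its boundary, so one vertex generates the line and further
    ones add nothing. *)
Lemma boundariesN1 K u : u \in vertices K ->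
  boundaries F K (0 - 1) = <[fchain F set0]>%VS.
Proof.
rewrite mem_vertices => Ku; rewrite /boundaries /chains limg_span.
apply: subv_anti; apply/andP; split; last first.
  rewrite -memvE; apply/memv_span/mapP; exists (fchain F [set u]).
    by rewrite map_f // mem_enum mem_faces0 Ku cards1.
  by rewrite bdry_fchain bdry_face1.
apply/span_subvP=> _ /mapP[t /mem_fchains[tau + ->] ->].
rewrite mem_faces0 => /andP[_ /cards1P[v ->]].
by rewrite bdry_fchain bdry_face1 memv_line.
Qed.

Lemma boundariesN2 K : set0 \in K -> boundaries F K (0 - 1 - 1) = 0%VS.
Proof.
move=> K0; rewrite /boundaries /chains (facesN1 K0) /fchains enum_set1 /=.
rewrite span_seq1 limg_line bdry_fchain bdry_face0.
by apply/eqP; rewrite -dimv_eq0 dim_vline eqxx.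
Qed.

(** As soon as there is a vertex, the empty face is a boundary; the quotient by boundaries is then
    zero and has the empty basis. *)
Lemma stake_setN1 K S u : set0 \in K -> u \in vertices K ->
  stake_set F K (0 - 1) S = (S == [set set0]).
Proof.
move=> K0 Ku; rewrite /stake_set facesN1 // subset1.
case: eqP => [->|_] /=.
  rewrite /basis_mod setDv {1 2 3}/fchains enum_set0 /= nil_free span_nil cap0v.
  rewrite add0v eqxx (boundariesN1 Ku) /chains facesN1 // /fchains enum_set1.
  by rewrite span_seq1 eqxx.
case: eqP => //= ->; apply/negP=> /and3P[_ + _].
rewrite setD0 (boundariesN1 Ku) /fchains enum_set1 span_seq1 capvv.
by rewrite -dimv_eq0 dim_vline fchain_neq0.
Qed.

(** The boundaries of dimension -1 form a line, so a basis is a single nonzero vector, and the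
    boundary of any vertex is one. *)
Lemma shrubbery0P K T u : u \in vertices K ->
  reflect (exists2 v, v \in vertices K & T = [set [set v]])
          (shrubbery F K 0 T).
Proof.
move=> Ku; rewrite /shrubbery (boundariesN1 Ku).
apply: (iffP andP) => [[/subsetP sT /eq_size_basis]|[v Kv ->]].
  rewrite dim_vline fchain_neq0 !size_map -cardE => /esym/eqP/cards1P[tau def].
  have := sT tau; rewrite def set11 mem_faces0 => /(_ isT)/andP[Kt].
  by case/cards1P=> v def_tau; exists v; rewrite ?mem_vertices -def_tau.
rewrite sub1set mem_faces0 cards1 -mem_vertices Kv /fchains enum_set1 /=.
by rewrite bdry_fchain bdry_face1 basisEdim span_seq1 subvv dim_vline
  fchain_neq0.
Qed.

Lemma hedge0P K (h : complex * complex) u : set0 \in K -> u \in vertices K ->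
  reflect (exists2 v, v \in vertices K & h = ([set set0], [set [set v]]))
          (hedge F K 0 h).
Proof.
move=> K0 Ku; rewrite /hedge (stake_setN1 _ K0 Ku).
apply: (iffP andP) => [[/eqP def /(shrubbery0P _ Ku)[v Kv defT]]|[v Kv ->]].
  by exists v; rewrite // -def -defT -surjective_pairing.
by split=> //; apply/(shrubbery0P _ Ku); exists v.
Qed.

(** The boundary of the empty face is zero, so a shrubbery in this dimension indexes a basis of the
    zero space. *)
Lemma shrubberyN1 K T : set0 \in K ->
  shrubbery F K (0 - 1) T = (T == set0).
Proof.
move=> K0; rewrite /shrubbery (boundariesN2 K0).
apply/andP/eqP => [[_ /eq_size_basis]|->].
  by rewrite dimv0 !size_map -cardE => /esym/eqP; rewrite cards_eq0 => /eqP.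
by rewrite sub0set /fchains enum_set0 /= basisEdim span_nil subvv dimv0.
Qed.

Lemma circuit0 : circuit F set0 set0 = fchain F set0.
Proof.
rewrite /circuit /the_chain /fchains enum_set0 span_nil.
apply: classical_sets.xget_unique => [|z [_]].
  by rewrite subrr mem0v bdry_fchain bdry_face0.
by rewrite memv0 subr_eq0 => /eqP.
Qed.

(** A chain on the single vertex [u] is a multiple of it, and the boundary has that multiple as
    coefficient on the empty face, so it must be 1. *)
Lemma shrub0 u : shrub F [set set0] [set [set u]] set0 = fchain F [set u].
Proof.
rewrite /shrub /the_chain /fchains enum_set1 span_seq1.
apply: classical_sets.xget_unique => [|z [/vlineP[c ->]]].
  split; first exact: memv_line.
    by rewrite bdry_fchain bdry_face1 chain_coefE eqxx.
  by move=> sigma; rewrite inE => /eqP->; rewrite eqxx.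
rewrite linearZ /= bdry_fchain bdry_face1 !chain_coefE eqxx mulr1 => -> _.
by rewrite scale1r.
Qed.

Lemma rim_spec K S v : stake_set F K 0 S -> [set v] \in K ->
  rim F K 0 S [set v] \in <<fchains F (faces K 0 :\: S)>>%VS /\
  fchain F [set v] - rim F K 0 S [set v] \in boundaries F K 0.
Proof.
move=> /stake_set_mod[_ ex] /ex[r rX rB]; rewrite /rim /the_chain.
set P := (P in classical_sets.xget 0 P).
exact: (classical_sets.xgetI 0 (P := P) (conj rX rB)).
Qed.

Lemma rim_eq K S v r : stake_set F K 0 S ->
    r \in <<fchains F (faces K 0 :\: S)>>%VS ->
    fchain F [set v] - r \in boundaries F K 0 ->
  rim F K 0 S [set v] = r.
Proof.
move=> /stake_set_mod[uniq _] rX rB; rewrite /rim /the_chain.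
apply: classical_sets.xget_unique => // r' [r'X r'B].
apply/eqP; rewrite -subr_eq0; apply/eqP/uniq; first exact: memvB.
have -> : r' - r = (fchain F [set v] - r) - (fchain F [set v] - r').
  by rewrite opprB [RHS]addrC addrA subrK.
exact: memvB.
Qed.

(** Projection onto the chains supported inside [C], used to show that a rim stays in the component
    of its vertex. *)
Definition restrict (C : {set 'I_3}) x : chain F :=
  [ffun tau : face => if tau \subset C then coef x tau else 0].

Lemma coef_restrict C x tau :
  coef (restrict C x) tau = if tau \subset C then coef x tau else 0.
Proof. by rewrite /coef ffunE. Qed.

Lemma restrict_boundary K (C : {set 'I_3}) x :
    (forall u v, [set u; v] \in K -> (u \in C) = (v \in C)) ->
  x \in boundaries F K 0 -> restrict C x \in boundaries F K 0.
Proof.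
move=> closedC xB.
pose P y := restrict C y \in boundaries F K 0.
apply: (boundaries0_ind (P := P)) xB => [|c u v y uv Kuv yB]; rewrite /P.
  suff -> : restrict C 0 = 0 by rewrite mem0v.
  by apply/ffunP=> tau; rewrite -!/(coef _ _) coef_restrict chain_coef0 if_same.
(* An edge has both ends in [C] or neither, so restriction either keeps its boundary or kills it. *)
have -> : restrict C (c *: (fchain F [set v] - fchain F [set u]) + y) =
          (if u \in C then c else 0) *: bdry F (fchain F [set u; v]) +
          restrict C y.
  rewrite bdry_fchain bdry_face2 //.
  apply/ffunP=> tau; rewrite -!/(coef _ _) chain_coefD !coef_restrict
    chain_coefZ.
  have N w : (w \in C) != (tau \subset C) -> (tau == [set w]) = false.
    by apply: contra_neqF => /eqP->; rewrite sub1set.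
  move: (N u) (N v); rewrite -(closedC _ _ Kuv) !chain_coefE.
  case: (tau \subset C); case: (u \in C) => // Nu Nv.
  - by rewrite Nu // Nv // subrr !mulr0.
  - by rewrite Nu // Nv // subrr mulr0 addr0.
  - by rewrite mul0r addr0.
rewrite memvD // memvZ // memv_img // fchain_span mem_faces Kuv cards2.
suff -> : u != v by [].
by apply: contraTneq uv => ->; rewrite ltnn.
Qed.

Lemma component_edge K v u w : [set u; w] \in K ->
  (u \in component K v) = (w \in component K v).
Proof.
move=> Kuw; rewrite !inE; apply/idP/idP => cv; apply: connect_trans cv _.
  exact: connect1.
by apply: connect1; rewrite setUC.
Qed.

(** Restricting the rim of [v] to the component of [v] gives a chain with the same defining
    properties, so by uniqueness the rim equals its restriction. *)
Lemma rim_component K S v u : stake_set F K 0 S -> [set v] \in K ->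
  u \notin component K v -> coef (rim F K 0 S [set v]) [set u] = 0.
Proof.
move=> stS Kv uC; have [rX rB] := rim_spec stS Kv.
rewrite (rim_eq (r := restrict (component K v) (rim F K 0 S [set v])) stS).
- by rewrite coef_restrict sub1set (negPf uC).
- apply/span_fchainsP=> tau /(span_fchainsP _ _ rX).
  by rewrite coef_restrict => ->; rewrite if_same.
rewrite (_ : _ - _ = restrict (component K v)
                       (fchain F [set v] - rim F K 0 S [set v])).
  exact: restrict_boundary (@component_edge K v) rB.
apply/ffunP=> tau; rewrite -!/(coef _ _).
rewrite chain_coefB !coef_restrict chain_coefB !coef_fchain.
case: ifP => // tC; rewrite subr0; case: eqP => // def.
by rewrite def sub1set inE connect0 in tC.
Qed.

End Hedges.

(** * The sylvan entries as sums over paths *)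

Section Koszul.

Variables (F : fieldType) (I : {pred {mpoly F[3]}}).
Hypothesis monI : monomial_ideal I.
Implicit Types (a b c : 'X_{1..3}) (tau : face) (v w : 'I_3).

Lemma monomial_ideal_le c c' : 'X_[c] \in I -> (c <= c')%MM -> 'X_[c'] \in I.
Proof.
case: monI => M IP /IP[r [q [Mr def]]] le_cc'; apply/IP.
exists r, (fun m => q m * 'X_[c' - c]); split=> //.
rewrite -(submK le_cc') addmC mpolyXD def mulr_suml; apply: eq_bigr => m _.
by rewrite addmC addmK mulrAC.
Qed.

(** Trades truncated subtraction for addition: a face is witnessed by a monomial of [I] that leaves
    room for it below [b]. *)
Lemma koszulP b tau :
  reflect (exists2 c, 'X_[c] \in I & (c + indic tau <= b)%MM)
          (tau \in koszul I b).
Proof.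
rewrite inE; apply: (iffP andP) => [[le_tb bI]|[c cI le_cb]].
  by exists (b - indic tau)%MM; rewrite ?submK ?lepm_refl.
split; first exact: lepm_trans (lem_addl _ _) le_cb.
apply: monomial_ideal_le cI _; apply/mnm_lepP=> v.
by move/mnm_lepP/(_ v): le_cb; rewrite mnmDE mnmBE; lia.
Qed.

Lemma koszul_subset b tau tau' :
  tau' \subset tau -> tau \in koszul I b -> tau' \in koszul I b.
Proof.
move=> /subsetP sub /koszulP[c cI le_cb]; apply/koszulP; exists c => //.
apply/mnm_lepP=> v; move/mnm_lepP/(_ v): le_cb.
rewrite !mnmDE !mnmE; apply: leq_trans.
by rewrite leq_add2l; case: (boolP (v \in tau')) => // /sub->.
Qed.

Lemma koszul_le b b' tau :
  (b <= b')%MM -> tau \in koszul I b -> tau \in koszul I b'.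
Proof.
move=> le_bb' /koszulP[c cI le_cb]; apply/koszulP; exists c => //.
exact: lepm_trans le_cb le_bb'.
Qed.

(** Here [a] itself is the witness, since it can be raised by one in every direction of [tau]
    without exceeding [b]. *)
Lemma koszul_supp a b tau : 'X_[a] \in I -> (a <= b)%MM ->
  {in tau, forall v, (b - a)%MM v != 0%N} -> tau \in koszul I b.
Proof.
move=> aI /mnm_lepP le_ab supp; apply/koszulP; exists a => //.
apply/mnm_lepP=> v; rewrite mnmDE mnmE; have := le_ab v.
by case: (boolP (v \in tau)) => [/supp|_]; rewrite ?mnmBE; lia.
Qed.

(** A witness for [tau] lies below [a], so it equals [a] by minimality and leaves no room for a
    vertex. *)
Lemma koszul_min_generator a tau :
  min_generator I a -> tau \in koszul I a -> tau = set0.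
Proof.
case=> aI amin /koszulP[c cI le_ca].
have def: c = a by apply: amin cI; apply: lepm_trans le_ca; exact: lem_addr.
apply/setP=> v; rewrite inE; apply/negP=> tv.
by move/mnm_lepP/(_ v): le_ca; rewrite mnmDE mnmE tv def; lia.
Qed.

End Koszul.

(** * Degrees and steps along a lattice path *)

Section Paths.

Implicit Types (a b : 'X_{1..3}) (ks : seq 'I_3).

Lemma path_deg_last a ks l : (size ks <= l)%N -> path_deg a ks l = a.
Proof. by move=> le; rewrite /path_deg big_geq ?addm0 //; lia. Qed.

Lemma path_degS a ks l : (l < size ks)%N ->
  path_deg a ks l = (path_deg a ks l.+1 + U_(step ks l.+1))%MM.
Proof.
by move=> lt; rewrite /path_deg big_ltn // -addmA [(U_(_) + _)%MM]addmC.
Qed.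

Lemma le_path_deg a ks l : (a <= path_deg a ks l)%MM.
Proof. exact: lem_addr. Qed.

Lemma path_deg_le a ks l l' : (l <= l')%N ->
  (path_deg a ks l' <= path_deg a ks l)%MM.
Proof.
move/subnK <-; elim: (l' - l)%N => [|m IHm]; first exact: lepm_refl.
rewrite addSn; apply: lepm_trans IHm; case: (ltnP (m + l) (size ks)) => lt.
  by rewrite [X in (_ <= X)%MM]path_degS // lem_addr.
by rewrite !path_deg_last ?lepm_refl // leqW.
Qed.

Lemma mdeg_path_deg a ks l : mdeg (path_deg a ks l - a) = (size ks - l)%N.
Proof.
rewrite /path_deg addmC addmK mdeg_sum.
under eq_bigr do rewrite mdeg1.
by rewrite sum_nat_const_nat muln1 subSS.
Qed.

Lemma step_supp a ks l : (l < size ks)%N ->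
  (path_deg a ks l - a)%MM (step ks l.+1) != 0%N.
Proof.
move=> lt; rewrite path_degS // mnmBE mnmDE mnm1E eqxx.
by have /mnm_lepP/(_ (step ks l.+1)) := le_path_deg a ks l.+1; lia.
Qed.

Lemma path_deg0 a b (ks : (mdeg (b - a)).-tuple 'I_3) :
  ks \in lattice_paths a b -> path_deg a ks 0 = b.
Proof. by rewrite inE => /eqP. Qed.

Lemma lattice_path_supp a b (ks : (mdeg (b - a)).-tuple 'I_3) l :
    ks \in lattice_paths a b -> (l < mdeg (b - a))%N ->
  (b - a)%MM (step ks l.+1) != 0%N.
Proof.
move=> ksP lt; have lt' : (l < size ks)%N by rewrite size_tuple.
have := step_supp a lt'.
have /mnm_lepP/(_ (step ks l.+1)) := path_deg_le a ks (leq0n l).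
by rewrite (path_deg0 ksP) !mnmBE; lia.
Qed.

Lemma mdeg_sub_gt0 a b : (a <= b)%MM -> a <> b -> (0 < mdeg (b - a))%N.
Proof.
move=> le_ab ne; rewrite lt0n mdeg_eq0; apply/eqP=> ba0.
by apply: ne; rewrite -(submK le_ab) ba0 addmC addm0.
Qed.

End Paths.

(** * Factoring sums over hedgerows *)

Section Sylvan.

Variables (F : fieldType) (I : {pred {mpoly F[3]}}).
Hypothesis monI : monomial_ideal I.
Implicit Types (a b : 'X_{1..3}) (u v w : 'I_3) (K : complex) (tau : face).

Lemma prod_sum_tuple (T : finType) (x0 : T) m (Q : nat -> pred T)
    (g : nat -> T -> F) :
  \prod_(1 <= l < m.+1) \sum_(x | Q l x) g l x =
  \sum_(t : m.-tuple T | all (fun l => Q l (nth x0 t l.-1)) (iota 1 m))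
    \prod_(1 <= l < m.+1) g l (nth x0 t l.-1).
Proof.
rewrite big_add1 big_mkord bigA_distr_big_dep.
rewrite (reindex (fun t : m.-tuple T => [ffun l : 'I_m => tnth t l])) /=.
  apply: eq_big => [t|t _]; last first.
    by rewrite big_add1 big_mkord; apply: eq_bigr => l _;
      rewrite ffunE (tnth_nth x0).
  apply/familyP/allP => [Qt [|l]|Qt l]; rewrite ?mem_iota //=.
    by rewrite add1n ltnS => lt; have := Qt (Ordinal lt);
      rewrite ffunE (tnth_nth x0).
  have := Qt l.+1; rewrite mem_iota /= add1n ltnS ltn_ord ffunE (tnth_nth x0).
  exact.
exists (fun f : {ffun 'I_m -> T} => [tuple f l | l < m]) => [t _|f _].
  by apply: eq_from_tnth => l; rewrite tnth_mktuple ffunE.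
by apply/ffunP=> l; rewrite ffunE tnth_mktuple.
Qed.

(** The components of a hedgerow are chosen independently, so a sum of products factors. Constant
    [f] and [g] give the number of hedgerows; rim and shrub coefficients give the sum of weights. *)
Lemma sum_hedgerows d a n (ks : n.-tuple 'I_3) (f : complex -> F)
    (g : nat -> complex * complex -> F) : (0 < n)%N ->
  \sum_(H in hedgerows I d a ks)
     f (top_stakes H) * \prod_(1 <= l < n) g l (hedge_at H l) =
  (\sum_(S | stake_set F (koszul I (path_deg a ks 0)) d S) f S) *
  (\prod_(1 <= l < n)
     \sum_(h | hedge F (koszul I (path_deg a ks l)) d h) g l h) *
  (\sum_(T | shrubbery F (koszul I a) (d - 1) T) 1).
Proof.
(* With [n] a successor, [n.-1] computes to the tuple length of [prod_sum_tuple]. *)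
case: n ks => // m ks _; rewrite (prod_sum_tuple (set0, set0)).
rewrite big_distrlr pair_big /= big_distrlr pair_big /=.
apply: eq_big => [[[S t] T]|[[S t] T] _]; last by rewrite mulr1.
by rewrite inE /= -andbA.
Qed.

Lemma sum_hedges0 K u (g : complex * complex -> F) :
    set0 \in K -> u \in vertices K ->
  \sum_(h | hedge F K 0 h) g h =
  \sum_(v in vertices K) g ([set set0], [set [set v]]).
Proof.
move=> K0 Ku; pose f (v : 'I_3) : complex * complex := ([set set0], [set [set
  v]]).
have injf : {in vertices K &, injective f}.
  by move=> v w _ _ [] /set1_inj/set1_inj.
rewrite -(big_imset g injf) /=; apply: eq_bigl => h.
apply/(hedge0P _ _ K0 Ku)/imsetP => [[v]|[v]]; by exists v.
Qed.

Lemma face_of_card1 tau v : #|tau| = 1%N -> v \in tau -> tau = [set v] :> face.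
Proof. by move=> /eqP/cards1P[w ->] /set1P->. Qed.

(** The only possible sequence tau_0, ..., tau_(n-1) of a fence in dimension 0. *)
Definition path_vertices n (ks : n.-tuple 'I_3) : n.-tuple face :=
  [tuple of [seq [set k] | k <- ks]].

Lemma path_vertexE n (ks : n.-tuple 'I_3) l : (l < n)%N ->
  nth set0 (path_vertices ks) l = [set step ks l.+1].
Proof. by move=> lt; rewrite (nth_map ord0) ?size_tuple. Qed.

(** * Fences along a fixed path *)

Section Fences.

Variables (a : 'X_{1..3}) (n : nat) (ks : n.-tuple 'I_3).
Hypotheses (gen_a : min_generator I a) (n_gt0 : (0 < n)%N).

Let deg l := path_deg a ks l.

Lemma path_koszul0 l : set0 \in koszul I (deg l).
Proof.
apply: (koszul_supp monI (proj1 gen_a) (le_path_deg a ks l)) => v.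
by rewrite inE.
Qed.

(** From b_l the path must still descend towards [a] in the direction k_(l+1). In particular every
    complex strictly before [a] has a vertex, as the description of hedges requires. *)
Lemma step_vertex l : (l < n)%N -> step ks l.+1 \in vertices (koszul I (deg l)).
Proof.
move=> lt; rewrite mem_vertices.
apply: (koszul_supp monI (proj1 gen_a) (le_path_deg a ks l)) => v.
by move/set1P->; rewrite step_supp ?size_tuple.
Qed.

Definition path_fence (H : hedgerow_data n) : fence_data n :=
  (H, (path_vertices ks, nseq_tuple n set0)).

Lemma fence_path v (phi : fence_data n) :
  phi \in fences I 0 a ks [set v] set0 -> path_fence phi.1 = phi.
Proof.
case: phi => H [t s]; rewrite inE => /and5P[_ /allP/= tP sP _ /andP[/allP/= stP
  _]].
have defs l : (l < n)%N -> nth set0 t l = [set step ks l.+1] /\ nth set0 s l =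
  set0.
  move=> lt; have := tP l; rewrite mem_iota lt => /(_ isT).
  rewrite mem_faces0 => /andP[_ /eqP card1].
  have := stP l.+1; rewrite mem_iota /= add1n ltnS lt => /(_ isT).
  case/andP=> /= /(face_of_card1 card1) def /eqP;
    rewrite /fence_tau /fence_sigma /= in def *.
  by move->; rewrite def setDv.
congr (_, (_, _)); apply/val_inj/(@eq_from_nth _ set0); rewrite ?size_tuple //.
  by move=> l lt; rewrite path_vertexE // (proj1 (defs l lt)).
by move=> l lt; rewrite (proj2 (defs l lt)) /= nth_nseq lt.
Qed.

Lemma hedgerow_hedge H l : H \in hedgerows I 0 a ks -> (0 < l < n)%N ->
  exists2 v, v \in vertices (koszul I (deg l)) &
             hedge_at H l = ([set set0], [set [set v]]).
Proof.
rewrite inE => /and3P[_ /allP hP _] /andP[l_gt0 lt].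
apply/(@hedge0P F _ _ _ (path_koszul0 l) (step_vertex lt)).
by apply: hP; rewrite mem_iota l_gt0 add1n prednK.
Qed.

Lemma hedgerow_bottom H : H \in hedgerows I 0 a ks -> bottom_shrubbery H = set0.
Proof.
rewrite inE => /and3P[_ _]; rewrite shrubberyN1 => [/eqP//|].
by have := path_koszul0 n; rewrite /deg path_deg_last ?size_tuple.
Qed.

Lemma path_fence_tau H l : (l < n)%N ->
  fence_tau (path_fence H) l = [set step ks l.+1].
Proof. exact: path_vertexE. Qed.

Lemma path_fence_sigma H l : fence_sigma (path_fence H) l = set0.
Proof. by rewrite /fence_sigma /= nth_nseq if_same. Qed.

Lemma path_fence_shrub H l : H \in hedgerows I 0 a ks -> (0 < l < n)%N ->
  coef (fence_shrub F (path_fence H) l) (fence_tau (path_fence H) l) =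
  ((hedge_at H l).2 == [set [set step ks l.+1]])%:R.
Proof.
move=> HP ltn; have [v _ def] := hedgerow_hedge HP ltn.
rewrite /fence_shrub path_fence_sigma def shrub0 path_fence_tau;
  last by case/andP: ltn.
rewrite chain_coefE; congr (_%:R); congr nat_of_bool.
by rewrite !(inj_eq set1_inj) eq_sym.
Qed.

Lemma path_fence_circuit H : H \in hedgerows I 0 a ks ->
  coef (fence_circuit F (path_fence H)) set0 = 1.
Proof.
move=> HP; rewrite /fence_circuit path_fence_sigma.
by rewrite (hedgerow_bottom HP) circuit0 chain_coefE eqxx.
Qed.

(** The weight of [path_fence H], extended to all hedgerows: the factor at [l] is the coefficient of
    tau_l in the shrub of the empty face, an indicator since that shrub is a single vertex. *)
Definition hedgerow_weight v (H : hedgerow_data n) : F :=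
  coef (rim F (koszul I (deg 0)) 0 (top_stakes H) [set v]) [set step ks 1] *
  \prod_(1 <= l < n) ((hedge_at H l).2 == [set [set step ks l.+1]])%:R.

Lemma path_fence_weight v H : H \in hedgerows I 0 a ks ->
  weight I 0 a ks [set v] set0 (path_fence H) = hedgerow_weight v H.
Proof.
move=> HP; rewrite /weight path_fence_circuit // mulr1.
rewrite [X in _ * X](_ : _ = 1) ?mulr1; last first.
  rewrite big_nat big1 // => l /andP[l0 ltl].
  rewrite path_fence_sigma path_fence_tau; last by rewrite prednK.
  by rewrite bdry_fchain bdry_face1 chain_coefE eqxx.
congr (_ * _); first by rewrite path_fence_tau.
by apply: eq_big_nat => l ltl; rewrite path_fence_shrub.
Qed.

(* Conversely, a hedgerow whose path_fence is not a fence has weight 0, so that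
   the sum over fences can be extended to all hedgerows. *)
Lemma mem_path_fence v H : H \in hedgerows I 0 a ks ->
  hedgerow_weight v H != 0 ->
  path_fence H \in fences I 0 a ks [set v] set0.
Proof.
move=> HP; rewrite mulf_eq0 negb_or => /andP[rim0 prod0].
rewrite inE HP /=; apply/and5P; split.
- apply/allP=> l; rewrite mem_iota /= => ltl.
  by rewrite path_fence_tau // mem_faces0 -mem_vertices step_vertex // cards1.
- apply/allP=> l; rewrite mem_iota => /andP[l0 ltl].
  by rewrite path_fence_sigma facesN1 ?set11 // path_koszul0.
- by rewrite path_fence_tau.
- apply/allP=> l; rewrite mem_iota => /andP[l0 ltl].
  by rewrite path_fence_sigma path_fence_tau ?prednK // set11 setDv eqxx.
rewrite path_fence_circuit // oner_eq0 andbT.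
apply/allP=> l; rewrite mem_iota add1n prednK // => ltl.
rewrite path_fence_sigma path_fence_shrub //.
have [u _ def] := hedgerow_hedge HP ltl; rewrite {1}def set11 /=.
by move: prod0; rewrite prodf_seq_neq0 => /allP/(_ l); rewrite mem_index_iota;
  apply.
Qed.

Lemma sum_fences v :
  \sum_(phi in fences I 0 a ks [set v] set0) weight I 0 a ks [set v] set0 phi =
  \sum_(H in hedgerows I 0 a ks) hedgerow_weight v H.
Proof.
(* A fence is recovered from its hedgerow, so the fences are indexed by the hedgerows [H] for which
   [path_fence H] is a fence. *)
rewrite (reindex_onto path_fence fst) /=; last exact: fence_path.
rewrite big_mkcond [RHS]big_mkcond; apply: eq_bigr => H _.
rewrite eqxx andbT; have [HP|HN] := boolP (H \in hedgerows I 0 a ks).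
  case: ifPn => [_|HN]; first exact: path_fence_weight.
  by apply/esym/eqP; apply: contraNT HN; apply: mem_path_fence.
by rewrite inE /= (negPf HN).
Qed.

(** The sum of weights and the number of hedgerows factor over the same degrees. At each interior
    degree there are as many hedges as vertices, and exactly one of them contributes. *)
Lemma path_sum v :
  (#|hedgerows I 0 a ks|%:R)^-1 *
    \sum_(phi in fences I 0 a ks [set v] set0)
      weight I 0 a ks [set v] set0 phi =
  (\sum_(S | stake_set F (koszul I (deg 0)) 0 S)
     coef (rim F (koszul I (deg 0)) 0 S [set v]) [set step ks 1]) /
  #|[set S | stake_set F (koszul I (deg 0)) 0 S]|%:R *
  \prod_(1 <= l < n) (#|vertices (koszul I (deg l))|%:R)^-1.
Proof.
pose one_hedge l (h : complex * complex) : F :=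
  (h.2 == [set [set step ks l.+1]])%:R.
have bottom1 : \sum_(T | shrubbery F (koszul I a) (0 - 1) T) 1 = 1 :> F.
  rewrite (big_pred1 set0) // => T; rewrite shrubberyN1 //.
  by have := path_koszul0 n; rewrite /deg path_deg_last ?size_tuple.
(* Hedgerows are counted by summing the constant 1. *)
have -> : #|hedgerows I 0 a ks|%:R =
    #|[set S | stake_set F (koszul I (deg 0)) 0 S]|%:R *
    \prod_(1 <= l < n) #|vertices (koszul I (deg l))|%:R :> F.
  have := @sum_hedgerows 0 a n ks (fun=> 1) (fun _ _ => 1) n_gt0.
  rewrite bottom1 mulr1.
  under [X in X = _ -> _]eq_bigr do rewrite big1_eq mulr1.
  rewrite !sumr_const => ->; rewrite cardsE; congr (_ * _).
  apply: eq_big_nat => l /andP[l0 ltl].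
  by rewrite (sum_hedges0 _ (path_koszul0 l) (step_vertex ltl)) sumr_const.
pose rim_coef S : F :=
  coef (rim F (koszul I (deg 0)) 0 S [set v]) [set step ks 1].
rewrite sum_fences [X in _ * X](sum_hedgerows 0 a ks rim_coef one_hedge n_gt0).
rewrite bottom1 mulr1.
(* Only the hedge at b_l whose shrubbery is the vertex k_(l+1) survives. *)
rewrite [X in _ * (_ * X)](_ : _ = 1); last first.
  rewrite big_nat big1 // => l /andP[l0 ltl].
  rewrite (sum_hedges0 _ (path_koszul0 l) (step_vertex ltl)).
  rewrite (bigD1 (step ks l.+1)) ?step_vertex //= /one_hedge eqxx big1 ?addr0
    //.
  by move=> u /andP[_ /negPf ne]; rewrite !(inj_eq set1_inj) ne.
by rewrite mulr1 invfM prodfV mulrC mulrA.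
Qed.

End Fences.

Lemma sylvanE a b v : min_generator I a -> (a <= b)%MM -> a <> b ->
  sylvan I 0 a b set0 [set v] =
  \sum_(ks in lattice_paths a b)
     (\sum_(S | stake_set F (koszul I b) 0 S)
        coef (rim F (koszul I b) 0 S [set v]) [set step ks 1]) /
     #|[set S | stake_set F (koszul I b) 0 S]|%:R *
     \prod_(1 <= l < mdeg (b - a))
        (#|vertices (koszul I (path_deg a ks l))|%:R)^-1.
Proof.
move=> gen_a le_ab ne_ab; apply: eq_bigr => ks ksP.
by rewrite path_sum ?mdeg_sub_gt0 // (path_deg0 ksP).
Qed.

End Sylvan.

(** * Stake sets *)

Section Stakes.

Variable F : fieldType.
Implicit Types (A K S T X : complex) (sigma tau : face) (x y z : chain F).
Implicit Types (i j k u v w : 'I_3).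

Lemma edge_boundary K u v : u != v -> [set u; v] \in K ->
  fchain F [set v] - fchain F [set u] \in boundaries F K 0.
Proof.
have lt_case u' v' : (u' < v')%N -> [set u'; v'] \in K ->
    fchain F [set v'] - fchain F [set u'] \in boundaries F K 0.
  move=> lt_uv Kuv; rewrite -bdry_face2 // -bdry_fchain memv_img //.
  rewrite fchain_span mem_faces Kuv cards2.
  suff -> : u' != v' by [].
  by apply: contraTneq lt_uv => ->; rewrite ltnn.
case: (ltngtP u v) => [lt _|lt _|/val_inj->]; last by rewrite eqxx.
  exact: lt_case.
(* The opposite orientation only changes the sign. *)
by rewrite setUC => Kuv; rewrite -opprB memvN lt_case.
Qed.

Lemma boundaries_chains K :
    (forall tau tau', tau' \subset tau -> tau \in K -> tau' \in K) ->
  (boundaries F K 0 <= chains F K 0)%VS.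
Proof.
move=> Ksub; apply/subvP; apply: boundaries0_ind => [|c u v x _ Kuv xB].
  exact: mem0v.
rewrite memvD // memvZ // memvB // fchain_span mem_faces0 cards1 andbT.
  by apply: Ksub Kuv; rewrite sub1set set22.
by apply: Ksub Kuv; rewrite sub1set set21.
Qed.

(** Basis extension: a maximal set [X] of vertices independent modulo boundaries spans the quotient,
    and its complement is a stake set. *)
Lemma stake_set_exists K :
    (forall tau tau', tau' \subset tau -> tau \in K -> tau' \in K) ->
  exists S, stake_set F K 0 S.
Proof.
move=> Ksub; pose indep X :=
  (X \subset faces K 0) && (<<fchains F X>> :&: boundaries F K 0 == 0)%VS.
have indep0 : indep set0.
  by rewrite /indep sub0set /fchains enum_set0 span_nil cap0v eqxx.
have [X /maxsetP[/andP[sX /eqP capX] maxX] _] := maxset_exists indep0.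
exists (faces K 0 :\: X); rewrite /stake_set subsetDl setDDr setDv set0U.
rewrite (setIidPr sX) /basis_mod free_fchains capX eqxx.
apply/eqP/subv_anti; rewrite subv_add boundaries_chains // andbT; apply/andP;
  split.
  apply/span_subvP=> _ /mem_fchains[tau Xt ->].
  by rewrite fchain_span (subsetP sX).
apply/span_subvP=> _ /mem_fchains[tau Kt ->].
have [Xt|XNt] := boolP (tau \in X).
  by rewrite (subvP (addvSl _ _)) // fchain_span.
(* Adding [tau] to the maximal [X] produces a nonzero boundary [z] in the larger span; solving [z]
   for [tau] expresses [tau] modulo boundaries. *)
suff: ~~ indep (tau |: X).
  rewrite /indep subUset sub1set Kt sX /= -vpick0.
  set z := vpick _ => z0; have: z \in (<<fchains F (tau |: X)>> :&: boundaries
    F K 0)%VS.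
    exact: memv_pick.
  rewrite memv_cap => /andP[/span_fchainsP zX zB].
  pose y := z - coef z tau *: fchain F tau.
  have yX : y \in <<fchains F X>>%VS.
    apply/span_fchainsP=> sigma sN; rewrite !chain_coefE.
    case: eqP => [->|/eqP ne]; first by rewrite mulr1 subrr.
    by rewrite mulr0 subr0 zX // !inE negb_or ne.
  (* If [tau] did not occur in [z], then [z] would be a nonzero boundary in the span of [X]. *)
  have [c0|c0] := eqVneq (coef z tau) 0.
    case/eqP: z0; apply/eqP; rewrite -memv0 -capX memv_cap zB andbT.
    by move: yX; rewrite /y c0 scale0r subr0.
  have -> : fchain F tau = (coef z tau)^-1 *: (- y + z).
    by rewrite /y opprB subrK scalerA mulVf // scale1r.
  by rewrite memvZ // memv_add // memvN.
apply: contra XNt => /maxX <-; last exact: subsetUr.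
exact: setU11.
Qed.

(** No edge contains [v], so no edge boundary involves it. *)
Lemma isolated_boundary K v x : isolated K v ->
  x \in boundaries F K 0 -> coef x [set v] = 0.
Proof.
case=> _ iso; move: x; apply: boundaries0_ind => [|c u w x uw Kuw x0].
  by rewrite chain_coefE.
have ne : u != w by apply: contraTneq uw => ->; rewrite ltnn.
have vN : v \notin [set u; w].
  apply/negP=> /(iso _ Kuw) def; have := cards2 u w.
  by rewrite def cards1 ne.
rewrite !chain_coefE x0 addr0 !(inj_eq set1_inj).
by move: vN; rewrite !inE negb_or => /andP[/negPf-> /negPf->];
  rewrite subrr mulr0.
Qed.

(** If [v] were a stake, its rim would avoid [v], and the difference would be a boundary with
    coefficient 1 on the isolated vertex [v]. *)
Lemma stake_isolated K S v : isolated K v -> stake_set F K 0 S -> [set v]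
  \notin S.
Proof.
move=> iso stS; have [_ ex] := stake_set_mod stS;
  have [r rX] := ex v (proj1 iso).
move/(isolated_boundary iso); rewrite !chain_coefE eqxx => /eqP.
apply: contraTN => Sv; rewrite (span_fchainsP _ _ rX) ?subr0 ?oner_eq0 //.
by rewrite inE Sv.
Qed.

Lemma rim_nonstake K S v : stake_set F K 0 S -> [set v] \in K ->
  [set v] \notin S -> rim F K 0 S [set v] = fchain F [set v].
Proof.
move=> stS Kv SNv; apply: rim_eq => //; last by rewrite subrr mem0v.
by rewrite fchain_span inE SNv mem_faces0 Kv cards1.
Qed.

(* The bound ensures that this number is invertible in characteristic > 3. *)
Lemma card_stake_sets K v : isolated K v ->
    (forall tau tau', tau' \subset tau -> tau \in K -> tau' \in K) ->
  (0 < #|[set S | stake_set F K 0 S]| <= 4)%N.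
Proof.
move=> iso Ksub; have [S stS] := stake_set_exists Ksub.
apply/andP; split; first by apply/card_gt0P; exists S; rewrite inE.
(* A stake set is a subset of the two vertices other than [v], which leaves at most 2^2
   possibilities. *)
pose V := [set [set w] | w in [set: 'I_3] :\ v] : complex.
have leV : (#|V| <= 2)%N.
  apply: leq_trans (leq_imset_card _ _) _.
  by rewrite -(leq_add2l (v \in [set: 'I_3])) -cardsD1 cardsT card_ord inE.
apply: (@leq_trans #|powerset V|); last by rewrite card_powerset (leq_pexp2l _
  leV).
apply/subset_leq_card/subsetP=> S'; rewrite inE powersetE => stS'.
apply/subsetP=> tau S't; case/andP: (stS') => /subsetP/(_ _ S't) + _.
rewrite mem_faces0 => /andP[_ /cards1P[w def]].
rewrite def imset_f // !inE andbT; apply: contraTneq S't => wv.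
by rewrite def wv (stake_isolated iso).
Qed.

Lemma uniq3P i j k : uniq [:: i; j; k] -> [/\ i != j, i != k & j != k].
Proof. by rewrite /= !inE negb_or => /and3P[/andP[-> ->] ->]. Qed.

(** * The complex formed by an edge and an isolated point *)

Section EdgePoint.

Variables (i j k : 'I_3) (K : complex).
Hypothesis ijk : uniq [:: i; j; k].
Hypothesis KE : forall tau, (tau \in K) = (tau \subset [set i;
  j]) || (tau \subset [set k]).

Lemma edge_point_subset tau tau' : tau' \subset tau -> tau \in K -> tau' \in K.
Proof. by move=> sub; rewrite !KE => /orP[]/(subset_trans sub)->;
  rewrite ?orbT. Qed.

Lemma edge_point_boundaryP x : x \in boundaries F K 0 ->
  exists c : F, x = c *: (fchain F [set j] - fchain F [set i]).
Proof.
move: x; apply: boundaries0_ind => [|c u v x uv Kuv [d ->]].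
  by exists 0; rewrite scale0r.
have: ((u == i) && (v == j)) || ((u == j) && (v == i)).
  move: Kuv uv; rewrite KE !subUset !sub1set !inE.
  case/orP=> [/andP[/orP[]/eqP-> /orP[]/eqP->]|/andP[/eqP-> /eqP->]];
    by rewrite ?ltnn ?eqxx ?orbT.
case/orP=> /andP[/eqP-> /eqP->]; first by exists (c + d); rewrite scalerDl.
by exists (d - c); rewrite scalerBl -scalerN opprB addrC.
Qed.

Lemma edge_point_vertex v : ([set v] \in faces K 0).
Proof.
rewrite mem_faces0 cards1 andbT KE !sub1set !inE.
have: v \in [:: i; j; k].
  (* Three distinct indices exhaust ['I_3]. *)
  suff -> : [:: i; j; k] =i 'I_3 by [].
  by apply/subset_cardP; rewrite ?subset_predT // (card_uniqP ijk) card_ord.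
by rewrite !inE orbA.
Qed.

Lemma edge_point_stake : stake_set F K 0 [set [set i]].
Proof.
have [ij _ _] := uniq3P ijk; rewrite /stake_set sub1set edge_point_vertex
  /basis_mod.
rewrite free_fchains /=; apply/andP; split.
  rewrite -subv0; apply/subvP=> x; rewrite memv_cap memv0.
  case/andP=> /span_fchainsP xX /edge_point_boundaryP[c def].
  (* The coefficient on [i] determines a boundary, so a boundary avoiding [i] vanishes. *)
  have := xX [set i]; rewrite def !inE eqxx => /(_ isT).
  rewrite !chain_coefE eqxx (inj_eq set1_inj) (negPf ij) sub0r mulrN1.
  by move/eqP; rewrite oppr_eq0 => /eqP->; rewrite scale0r.
apply/eqP/subv_anti; rewrite subv_add (boundaries_chains edge_point_subset)
  andbT.
apply/andP; split; apply/span_subvP=> _ /mem_fchains[tau + ->].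
  by rewrite fchain_span inE => /andP[].
move=> Kt; have [->|ne] := eqVneq tau [set i].
  (* The removed vertex is recovered as i = j - (j - i). *)
  rewrite -[fchain F [set i]](subKr (fchain F [set j])) memv_add //.
    by rewrite fchain_span !inE (inj_eq set1_inj) eq_sym ij -mem_faces0
      edge_point_vertex.
  by rewrite memvN edge_boundary // KE subxx.
by rewrite (subvP (addvSl _ _)) // fchain_span !inE ne -mem_faces0.
Qed.

End EdgePoint.

(** The isolated vertex [k] is never a stake, and since the boundaries form the line through j - i,
    exactly one of [i] and [j] is a stake. *)
Lemma edge_point_stakesE i j k K S : uniq [:: i; j; k] ->
    (forall tau,
       (tau \in K) = (tau \subset [set i; j]) || (tau \subset [set k])) ->
  stake_set F K 0 S = (S == [set [set i]]) || (S == [set [set j]]).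
Proof.
move=> ijk KE; apply/idP/orP => [stS|[]/eqP->]; last 2 first.
- exact: edge_point_stake ijk KE.
- apply: (@edge_point_stake j i k) => [|tau]; last by rewrite KE setUC.
  move: ijk; rewrite /= !inE (eq_sym i j) !negb_or => /and3P[].
  by case/andP=> -> -> ->.
have [ij ik jk] := uniq3P ijk.
have isok : isolated K k.
  split=> [|tau]; first by rewrite KE subxx orbT.
  rewrite KE => /orP[/subsetP sub /sub|]; last first.
    by rewrite subset1 => /orP[/eqP//|/eqP->]; rewrite inE.
  by rewrite !inE ![k == _]eq_sym (negPf ik) (negPf jk).
have sS : S \subset [set [set i]; [set j]].
  apply/subsetP=> tau St; case/andP: (stS) => /subsetP/(_ _ St) + _.
  rewrite mem_faces0 => /andP[+ /cards1P[v def]];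
    rewrite def KE !sub1set => /orP[].
    by rewrite !inE !(inj_eq set1_inj).
  rewrite inE => /eqP vk; have := stake_isolated isok stS.
  by rewrite -vk -def St.
have nij : [set j] != [set i] :> face by rewrite (inj_eq set1_inj) eq_sym.
have [uniqX exX] := stake_set_mod stS.
have ijB : fchain F [set j] - fchain F [set i] \in boundaries F K 0.
  by apply: edge_boundary; rewrite // KE subxx.
(* If neither end were a stake, the nonzero boundary j - i would lie in the span of the complement
   of [S]. *)
have one : ([set i] \in S) || ([set j] \in S).
  apply/norP=> -[SNi SNj]; have: fchain F [set j] - fchain F [set i] = 0.
    apply: uniqX ijB; rewrite memvB // fchain_span inE ?SNi ?SNj.
      exact: edge_point_vertex ijk KE _.
    exact: edge_point_vertex ijk KE _.
  move/ffunP/(_ [set j]); rewrite -!/(coef _ _) !chain_coefE eqxx (negPf nij)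
    subr0.
  by move/eqP; rewrite oner_eq0.
(* If both ends were stakes, the rim of [i] would avoid both, forcing [i] minus the rim to be a
   multiple of j - i with coefficients 1 on [i] and 0 on [j]. *)
have notboth : ~~ (([set i] \in S) && ([set j] \in S)).
  apply/negP=> /andP[Si Sj].
  have Ki : [set i] \in K by rewrite KE sub1set set21.
  have [r /span_fchainsP rX] := exX _ Ki.
  case/(edge_point_boundaryP KE) => c /ffunP def.
  have := def [set j]; have := def [set i]; rewrite -!/(coef _ _) !chain_coefE.
  rewrite !rX ?inE ?Si ?Sj // !eqxx (eq_sym [set i]) (negPf nij).
  rewrite !subr0 mulr1 => + Ec; rewrite -Ec.
  by rewrite mul0r => /eqP; rewrite oner_eq0.
have [Si|SNi] := boolP ([set i] \in S).
  left; rewrite eqEsubset sub1set Si andbT; apply/subsetP=> tau St.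
  have := subsetP sS _ St; rewrite !inE => /orP[//|/eqP def].
  by move: notboth; rewrite Si -def St.
right; rewrite (negPf SNi) /= in one; rewrite eqEsubset sub1set one andbT.
apply/subsetP=> tau St; have := subsetP sS _ St;
  rewrite !inE => /orP[/eqP def|//].
by rewrite -def St in SNi.
Qed.

(** The rim of [i] is [j] when [i] is the stake and [i] when [j] is the stake, so each end of the
    edge is hit once. *)
Lemma edge_point_rim_sum i j k K u : uniq [:: i; j; k] ->
    (forall tau,
       (tau \in K) = (tau \subset [set i; j]) || (tau \subset [set k])) ->
    u \in [set i; j] ->
  \sum_(S | stake_set F K 0 S) coef (rim F K 0 S [set i]) [set u] = 1.
Proof.
move=> ijk KE uij; have stE S := edge_point_stakesE S ijk KE.
have [ij _ _] := uniq3P ijk.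
have ne : [set [set j]] != [set [set i]] :> complex.
  by rewrite !(inj_eq set1_inj) eq_sym.
rewrite (bigD1 [set [set i]]) ?stE ?eqxx //=.
rewrite (big_pred1 [set [set j]]) => [|S]; last first.
  by rewrite stE /=; case: (eqVneq S [set [set j]]) => [->|_];
    rewrite ?orbT ?orbF ?andbN.
rewrite (rim_eq (r := fchain F [set j])); first last.
- by apply: edge_boundary; rewrite 1?eq_sym // setUC KE subxx.
- by rewrite fchain_span !inE -in_set1 inE (inj_eq set1_inj) eq_sym ij
  -mem_faces0
     (edge_point_vertex ijk KE).
- by rewrite stE eqxx.
rewrite rim_nonstake ?stE ?eqxx ?orbT ?KE ?sub1set ?set21 //; last first.
  by rewrite inE (inj_eq set1_inj).
rewrite !chain_coefE !(inj_eq set1_inj).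
by case/set2P: uij => ->; rewrite eqxx ?(negPf ij) 1?eq_sym ?(negPf ij) ?addr0
  ?add0r.
Qed.

Lemma edge_point_card_stakes i j k K : uniq [:: i; j; k] ->
    (forall tau,
       (tau \in K) = (tau \subset [set i; j]) || (tau \subset [set k])) ->
  #|[set S | stake_set F K 0 S]| = 2%N.
Proof.
move=> ijk KE; have [ij _ _] := uniq3P ijk.
have -> : [set S | stake_set F K 0 S] = [set [set [set i]]; [set [set j]]].
  by apply/setP=> S; rewrite !inE (edge_point_stakesE S ijk KE).
by rewrite cards2 !(inj_eq set1_inj) ij.
Qed.

End Stakes.

(** * The three cases *)

Section Cases.

Variables (F : fieldType) (I : {pred {mpoly F[3]}}).
Hypothesis monI : monomial_ideal I.
Implicit Types (a b c : 'X_{1..3}) (i j k u v w : 'I_3) (K : complex) (tau :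
  face).

(** The same witness works, because raising coordinate [v] by one makes room for the vertex [v]. *)
Lemma koszul_setU1 c v tau : v \notin tau -> tau \in koszul I c ->
  v |: tau \in koszul I (c + U_(v))%MM.
Proof.
move=> tv /(koszulP monI)[d dI le_dc]; apply/(koszulP monI); exists d => //.
apply/mnm_lepP=> w; move/mnm_lepP/(_ w): le_dc.
rewrite !mnmDE mnm1E !mnmE !inE (eq_sym v w); case: eqVneq => [->|_] /=;
  last by rewrite addn0.
by rewrite (negPf tv) addn0 addn1 addn1 ltnS.
Qed.

Lemma pchar_natr_neq0 m : 2%N \notin [pchar F] -> 3%N \notin [pchar F] ->
  (0 < m <= 4)%N -> m%:R != 0 :> F.
Proof.
rewrite !inE /= => n2 n3; case: m => [|[|[|[|[|m]]]]] //= _.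
  exact: oner_neq0.
by rewrite (natrM _ 2 2) mulf_neq0.
Qed.

(** * Vertices of the Koszul complexes along a path *)

Section Path.

Variables (a b : 'X_{1..3}) (ks : (mdeg (b - a)).-tuple 'I_3).
Hypotheses (gen_a : min_generator I a) (ksP : ks \in lattice_paths a b).

(** A vertex at b_l with l > 0 persists up to b_1, and b is b_1 raised by one in the direction k_1,
    which joins k_1 to that vertex. *)
Lemma path_edge l v : (0 < l)%N -> (0 < mdeg (b - a))%N ->
    v != step ks 1 -> v \in vertices (koszul I (path_deg a ks l)) ->
  [set step ks 1; v] \in koszul I b.
Proof.
move=> l0 n0 ne; rewrite mem_vertices => /(koszul_le monI (path_deg_le a ks
  l0)) Kv.
rewrite -[X in _ \in koszul I X](path_deg0 ksP) path_degS ?size_tuple //.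
by apply: koszul_setU1 Kv; rewrite inE eq_sym.
Qed.

Lemma card_vertices_path l : (l < mdeg (b - a))%N ->
  (0 < #|vertices (koszul I (path_deg a ks l))|)%N.
Proof.
by move=> lt; apply/card_gt0P; exists (step ks l.+1); apply: step_vertex.
Qed.

End Path.

Lemma lies_behind_supp a b (G : {set 'I_3}) v :
  lies_behind a b G -> (b - a)%MM v != 0%N -> v \in G.
Proof. by case/andP=> _ /subsetP sub ba; apply: sub; rewrite inE. Qed.

(** Both degrees agree with [b] away from [v], so they are comparable, and minimality makes them
    equal. *)
Lemma min_generator_behind1 a a' b v :
    min_generator I a -> lies_behind a b [set v] ->
    min_generator I a' -> lies_behind a' b [set v] -> a' = a.
Proof.
move=> [aI amin] ab [a'I a'min] a'b.
have le_ab := proj1 (andP ab); have le_a'b := proj1 (andP a'b).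
have eqv w : w != v -> a w = a' w.
  move=> wv; move/mnm_lepP/(_ w): le_ab; move/mnm_lepP/(_ w): le_a'b.
  have := @lies_behind_supp _ _ _ w ab; have := @lies_behind_supp _ _ _ w a'b.
  rewrite !inE (negPf wv) !mnmBE.
  case: (eqVneq (b w - a w)%N 0%N) => [|_ _ /(_ isT)//].
  case: (eqVneq (b w - a' w)%N 0%N) => [|_ _ /(_ isT)//].
  by lia.
have le_of c c' : (forall w, w != v -> c w = c' w) -> (c v <= c' v)%N -> (c <=
  c')%MM.
  by move=> eqc lev; apply/mnm_lepP=> w; case: (eqVneq w v) => [->|/eqc->].
case/orP: (leq_total (a v) (a' v)) => le.
  by apply/esym/a'min => //; apply: le_of.
by apply: amin => //; apply: le_of => // w /eqv.
Qed.

Lemma lattice_paths_behind1 a b v : lies_behind a b [set v] ->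
  lattice_paths a b = [set nseq_tuple (mdeg (b - a)) v].
Proof.
move=> ab; have suppv w : w != v -> (b - a)%MM w = 0%N.
  move=> wv; apply/eqP; have := @lies_behind_supp _ _ _ w ab.
  by rewrite inE (negPf wv); case: eqP => // _ /(_ isT).
have step_nseq m l : (l < m)%N -> step (nseq m v) l.+1 = v.
  by move=> lt; rewrite /step /= nth_nseq lt.
apply/setP=> ks; rewrite in_set1; apply/idP/eqP => [ksP|->].
  apply/val_inj/(@eq_from_nth _ ord0); rewrite !size_tuple // => l lt.
  have := lies_behind_supp ab (lattice_path_supp ksP lt); rewrite inE => /eqP.
  by rewrite /step /= nth_nseq lt.
rewrite inE; apply/eqP/mnmP=> w; rewrite /path_deg mnmDE mnm_sumE size_nseq.
have -> : (\sum_(1 <= m < (mdeg (b - a)).+1)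
             U_(step (nseq (mdeg (b - a)) v) m)%MM w)%N = (b - a)%MM w.
  rewrite big_add1 /= (eq_big_nat _ _ (F2 := fun=> U_(v)%MM w)); last first.
    by move=> l /andP[_ lt]; rewrite step_nseq.
  rewrite sum_nat_const_nat subn0 mdegE (bigD1 v) //= big1 ?addn0 //.
  rewrite mnm1E; case: (eqVneq v w) => [->|wv]; first by rewrite muln1.
  by rewrite muln0 suppv // eq_sym.
by rewrite mnmBE subnKC //; case/andP: ab => /mnm_lepP.
Qed.

Lemma sylvan_isolated a b v :
    2%N \notin [pchar F] -> 3%N \notin [pchar F] ->
    min_generator I a -> a <> b -> isolated (koszul I b) v ->
    lies_behind a b [set v] ->
  sylvan I 0 a b set0 [set v] = 1.
Proof.
move=> char2 char3 gen_a ne_ab iso ab; have le_ab := proj1 (andP ab).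
have n0 := mdeg_sub_gt0 le_ab ne_ab.
rewrite (sylvanE monI) // (lattice_paths_behind1 ab) big_set1.
set ks := nseq_tuple _ _.
have ksP : ks \in lattice_paths a b by rewrite (lattice_paths_behind1 ab) set11.
have stepE l : (l < mdeg (b - a))%N -> step ks l.+1 = v.
  by move=> lt; rewrite /step nth_nseq lt.
rewrite stepE // [X in _ * X](_ : _ = 1) ?mulr1; last first.
  (* Below [b] only [v] remains a vertex: any other one would be joined to [v] in the complex at
     [b], where [v] is isolated. *)
  rewrite big_nat big1 // => l /andP[l0 lt].
  suff -> : vertices (koszul I (path_deg a ks l)) = [set v].
    by rewrite cards1 invr1.
  apply/eqP; rewrite eqEsubset sub1set -{2}(stepE _ lt) step_vertex // andbT.
  apply/subsetP=> w wV; rewrite inE; apply: contraT => ne.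
  have /(proj2 iso) : [set v; w] \in koszul I b.
    by rewrite -(stepE _ n0) (path_edge ksP l0) // stepE.
  by rewrite set21 => /(_ isT)/setP/(_ w); rewrite !inE eqxx orbT (negPf ne).
(* The isolated [v] is never a stake, so it is its own rim for every stake set. Averaging then needs
   the number of stake sets, at most 4, to be invertible. *)
rewrite (eq_bigr (fun=> 1)) => [|S stS]; last first.
  by rewrite rim_nonstake ?(stake_isolated iso stS) ?(proj1 iso) // chain_coefE
    eqxx.
rewrite sumr_const -cardsE divff // pchar_natr_neq0 //.
by apply: card_stake_sets iso _ => tau tau'; apply: koszul_subset.
Qed.

Lemma sylvan_not_behind a b v :
    min_generator I a -> (a <= b)%MM -> a <> b ->
    [set v] \in koszul I b ->
    ~ lies_behind a b (component (koszul I b) v) ->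
  sylvan I 0 a b set0 [set v] = 0.
Proof.
move=> gen_a le_ab ne_ab Kv; rewrite /lies_behind le_ab /= => /negP/subsetPn[w].
rewrite inE => suppw wC; rewrite (sylvanE monI) // big1 // => ks ksP.
rewrite big1 ?mul0r // => S stS; apply: rim_component => //.
apply: contra wC => uC; have supp1 := lattice_path_supp ksP (mdeg_sub_gt0 le_ab
  ne_ab).
(* Both k_1 and [w] lie in the support of b - a, so together they form a face at [b], placing [w] in
   the component of k_1. *)
rewrite -(component_edge v (u := step ks 1)) //.
apply: (koszul_supp monI (proj1 gen_a) le_ab) => x.
by rewrite !inE => /orP[]/eqP->.
Qed.

(** In a complex closed under subsets, every face lies in a maximal one, so the facets determine the
    complex. *)
Lemma facets_edge_point K i j k :
    (forall tau tau', tau' \subset tau -> tau \in K -> tau' \in K) ->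
    facets K = [set [set i; j]; [set k]] ->
  forall tau, (tau \in K) = (tau \subset [set i; j]) || (tau \subset [set k]).
Proof.
move=> Ksub facE tau; apply/idP/orP => [Kt|[]sub].
- have [X maxX subX] := maxset_exists (P := mem K) Kt.
  have : X \in facets K by rewrite inE.
  by rewrite facE !inE => /orP[]/eqP <-; [left|right].
- have : [set i; j] \in facets K by rewrite facE set21.
  by rewrite inE => /maxsetP[KX _]; apply: Ksub KX.
have : [set k] \in facets K by rewrite facE set22.
by rewrite inE => /maxsetP[KX _]; apply: Ksub KX.
Qed.

Lemma sylvan_edge_point a b i j k :
    2%N \notin [pchar F] -> uniq [:: i; j; k] ->
    min_generator I a -> a <> b ->
    facets (koszul I b) = [set [set i; j]; [set k]] ->
    lies_behind a b [set i; j] ->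
  sylvan I 0 a b set0 [set i] =
  (2%:R ^+ mdeg (b - a))^-1 *
  \sum_(ks in lattice_paths a b) 2%:R ^+ mdeg (closest_deg I a ks - a).
Proof.
move=> char2 ijk gen_a ne_ab facE ab; have le_ab := proj1 (andP ab).
have KE := facets_edge_point (@koszul_subset _ _ monI b) facE.
have n0 := mdeg_sub_gt0 le_ab ne_ab.
have nz2 : 2%:R != 0 :> F by move: char2; rewrite inE.
have [ij ik jk] := uniq3P ijk.
rewrite (sylvanE monI) // mulr_sumr; apply: eq_bigr => ks ksP.
set n := mdeg (b - a); pose V l := vertices (koszul I (path_deg a ks l)).
have step1 : step ks 1 \in [set i; j].
  exact: lies_behind_supp ab (lattice_path_supp ksP n0).
rewrite (edge_point_rim_sum F ijk KE step1) (edge_point_card_stakes F ijk KE).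
have V_sub l l' : (l <= l')%N -> V l' \subset V l.
  move=> le; apply/subsetP=> v; rewrite !mem_vertices.
  exact/(koszul_le monI)/path_deg_le.
(* There are no vertices at [a], so the default index [n] in [closest_deg] satisfies the required
   bound. *)
have Vn0 : V n = set0.
  apply/setP=> v; rewrite mem_vertices path_deg_last ?size_tuple // in_set0.
  apply/negbTE/negP=> /(koszul_min_generator monI gen_a)/setP/(_ v).
  by rewrite !inE eqxx.
(* A vertex off the edge would be joined to k_1, an end of the edge, by a face that the complex at
   [b] does not have. *)
have Vij l : (0 < l)%N -> V l \subset [set i; j].
  move=> l0; apply/subsetP=> v vV; apply: contraT => vN.
  have ne : v != step ks 1 by apply: contraNneq vN => ->.
  move: (path_edge ksP l0 n0 ne vV); rewrite KE subUset !sub1set (negPf vN)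
    andbF /=.
  by rewrite subUset !sub1set inE; case/set2P: step1 => ->;
    rewrite ?(negPf ik) ?(negPf jk).
rewrite /closest_deg; case: arg_minnP => [|m Vm minm] /=.
  by rewrite -/(V _) Vn0 cards0.
rewrite -/(V m) in Vm; rewrite mdeg_path_deg size_tuple -/n.
(* All three vertices are present at [b], so the minimal index [m] is positive. *)
have V0 : (2 < #|V 0%N|)%N.
  apply: (@leq_trans #|[set: 'I_3]|); first by rewrite cardsT card_ord.
  apply/subset_leq_card/subsetP=> v _.
  by have := edge_point_vertex ijk KE v; rewrite mem_faces0 /V (path_deg0 ksP)
    mem_vertices => /andP[].
have m0 : (0 < m)%N.
  by rewrite lt0n; apply: contraTneq Vm => ->; rewrite -ltnNge; apply: ltnW.
have le_mn : (m <= n)%N by rewrite -ltnS.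
have V2 l : (0 < l < m)%N -> #|V l| = 2%N.
  case/andP=> l0 lt; apply/eqP; rewrite eqn_leq; apply/andP; split.
    by apply: leq_trans (subset_leq_card (Vij _ l0)) _; rewrite cards2 ij.
  rewrite ltnNge; apply/negP=> Vl.
  have ltn : (l < n.+1)%N by rewrite ltnS; apply: leq_trans le_mn; apply: ltnW.
  by have := minm (Ordinal ltn) Vl; rewrite leqNgt lt.
have V1 l : (m <= l < n)%N -> #|V l| = 1%N.
  case/andP=> le lt; apply/eqP; rewrite eqn_leq card_vertices_path // andbT.
  exact: leq_trans (subset_leq_card (V_sub _ _ le)) Vm.
(* The product splits at [m]: factors 1/2 before it and 1 from there on. *)
rewrite (big_cat_nat m0 le_mn) /=.
rewrite (eq_big_nat _ _ (F2 := fun=> 2%:R^-1)) => [|l /V2]; last first.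
  by rewrite /V => ->.
rewrite [X in _ * (_ * X)](eq_big_nat _ _ (F2 := fun=> 1)) => [|l /V1];
  last first.
  by rewrite /V => ->; rewrite invr1.
(* The 1/2 from averaging over the two stake sets and the m - 1 factors 1/2 give 2^(-m), which is
   2^(n-m) / 2^n. *)
rewrite big1_eq mulr1 prodr_const_nat mul1r -exprS subn1 prednK //.
by rewrite exprVn -{2}(subnK le_mn) exprD invfM mulrAC mulVf ?mul1r ?expf_neq0.
Qed.

End Cases.

Theorem theorem3p1 (F : fieldType)
    (char2 : 2%N \notin [pchar F]) (char3 : 3%N \notin [pchar F])
    (i j k : 'I_3) (ijk : uniq [:: i; j; k])
    (I : {pred {mpoly F[3]}}) (monI : monomial_ideal I)
    (a b : 'X_{1..3}) (le_ab : (a <= b)%MM) (neq_ab : a <> b)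
    (H0b : \dim (red_homology F (koszul I b) 0) <> 0%N)
    (gen_a : min_generator I a) :
  [/\ isolated (koszul I b) i -> lies_behind a b [set i] ->
        (forall a' : 'X_{1..3},
           min_generator I a' -> lies_behind a' b [set i] -> a' = a) /\
        sylvan I 0 a b set0 [set i] = 1,
      forall v : 'I_3, [set v] \in koszul I b ->
        ~ lies_behind a b (component (koszul I b) v) ->
        sylvan I 0 a b set0 [set v] = 0
    & facets (koszul I b) = [set [set i; j]; [set k]] ->
      lies_behind a b [set i; j] ->
        sylvan I 0 a b set0 [set i] =
        (2%:R ^+ mdeg (b - a))^-1 *
        \sum_(ks in lattice_paths a b)
          2%:R ^+ mdeg (closest_deg I a ks - a)].
Proof.
split=> [iso ab|v Kv nab|facE ab].
- split; first by move=> a'; apply: min_generator_behind1.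
  exact: sylvan_isolated.
- exact: sylvan_not_behind.
exact: sylvan_edge_point facE ab.
Qed.
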